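(* Suppose that $\mathbf R,\mathbf P\in\mathbb R^{N\times\bar N}$ have counterparts $\mathbf R_\perp,\mathbf P_\perp\in\mathbb R^{N\times(N-\bar N)}$ such that $\boldsymbol\xi=\mathbf P\mathbf R^T\boldsymbol\xi+\mathbf P_\perp\mathbf R_\perp^T\boldsymbol\xi$ for all $\boldsymbol\xi\in\mathbb R^N$, and that there are constants $M_{\mathbf P},M_{\mathbf P_\perp}\in\mathbb R$ with $\|\mathbf P\boldsymbol\eta\|\le M_{\mathbf P}\|\boldsymbol\eta\|$ for all $\boldsymbol\eta\in\mathbb R^{\bar N}$ and $\|\mathbf P_\perp\boldsymbol\eta\|\le M_{\mathbf P_\perp}\|\boldsymbol\eta\|$ for all $\boldsymbol\eta\in\mathbb R^{N-\bar N}$. Then for all $\boldsymbol\xi\in\mathbb R^N$ and all $n\in\{0,\dots,M-1\}$, $$\|\mathcal F(\boldsymbol\xi;T^n,T^{n+1})-\mathcal G_{\mathrm{LF}}(\boldsymbol\xi;T^n,T^{n+1})\|\le M_{\mathbf P_\perp}\|\mathbf R_\perp^T\mathcal F(\boldsymbol\xi;T^n,T^{n+1})\|+M_{\mathbf P}\sum_{j=1}^{\bar N}\beta_j^n\left\|\left(\mathbf I_{\bar m}-\boldsymbol\Xi_j^n[\boldsymbol\Xi_j^n]^T\right)\begin{bmatrix}\mathbf r_j^T\mathcal F(\boldsymbol\xi;T^n,t^{\bar m n+1})-\mathbf r_j^T\boldsymbol\xi\\ \vdots\\ \mathbf r_j^T\mathcal F(\boldsymbol\xi;T^n,T^{n+1})-\mathbf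 r_j^T\boldsymbol\xi\end{bmatrix}\right\|,$$ where $\beta_j^n:=1/\sigma_{\min}(\mathbf Z_0\boldsymbol\Xi_j^n)\ge 1$.
   Context: Norms are Euclidean. Let $N,M,\bar m\in\mathbb N$ be positive, $m=\bar m M$, $T_{\mathrm{final}}>0$, $h=T_{\mathrm{final}}/m$, $H=T_{\mathrm{final}}/M=\bar m h$. The fine time instances are $t^i=ih$, $0\le i\le m$, and the coarse time instances are $T^n=nH=t^{\bar m n}$, $0\le n\le M$. The fine propagator maps a state $\boldsymbol\xi\in\mathbb R^N$ at time $t^i$ to a state $\mathcal F(\boldsymbol\xi;t^i,t^j)\in\mathbb R^N$ at time $t^j$, $0\le i\le j\le m$, and satisfies $\mathcal F(\boldsymbol\xi;t^i,t^k)=\mathcal F(\mathcal F(\boldsymbol\xi;t^i,t^j);t^j,t^k)$ for $0\le i\le j\le k\le m$. Let $1\le\bar N\le N$. $\mathbf R=[\mathbf r_1\ \cdots\ \mathbf r_{\bar N}]\in\mathbb R^{N\times\bar N}$ ($\mathbf R^T$ is the restriction operator) and $\mathbf P\in\mathbb R^{N\times\bar N}$ is the prolongation operator. The memory $\alpha$ and basis dimension $a$ are positive integers with $a\le\alpha\le\bar m$. For $1\le j\le\bar N$ and $0\le n\le M-1$ the local time-evolution basis $\boldsymbol\Xi_j^n\in\mathbb R^{\bar m\times a}$ has orthonormal columns. $\mathbf Z_0\in\{0,1\}^{\alpha\times\bar m}$ is the matrix that extracts the first $\alpha$ entries of a vector in $\mathbb R^{\bar m}$; each $\mathbf Z_0\boldsymbol\Xi_j^n$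 is assumed to have full column rank, and $\sigma_{\min}$ denotes the smallest singular value. With $^+$ the Moore--Penrose pseudoinverse and $\mathbf e_i$ canonical unit vectors, put $\gamma_{ij}^n:=\mathbf e_{\bar m}^T\boldsymbol\Xi_j^n[\mathbf Z_0\boldsymbol\Xi_j^n]^+\mathbf e_i\in\mathbb R$ ($1\le i\le\alpha$) and $\boldsymbol\Gamma_i^n:=\mathrm{diag}(\gamma_{i1}^n,\dots,\gamma_{i\bar N}^n)$. The local-forecast coarse propagator is $$\mathcal G_{\mathrm{LF}}(\boldsymbol\xi;T^n,T^{n+1})=\mathbf P\mathbf R^T\boldsymbol\xi+\mathbf P\sum_{i=1}^{\alpha}\boldsymbol\Gamma_i^n\left[\mathbf R^T\mathcal F(\boldsymbol\xi;T^n,t^{\bar m n+i})-\mathbf R^T\boldsymbol\xi\right].$$ *)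

(* Defs.v *)
From mathcomp Require Import all_boot all_order all_algebra.
From mathcomp Require Import boolp classical_sets reals.

Set Implicit Arguments.
Unset Strict Implicit.
Unset Printing Implicit Defensive.

Import Order.TTheory GRing.Theory Num.Theory.
Local Open Scope ring_scope.
Local Open Scope classical_set_scope.

(* The norm that MathComp-Analysis puts on matrices is the sup norm, hence
   this separate definition. *)
Definition enorm (R : realType) (d : nat) (v : 'cV[R]_d) : R :=
  Num.sqrt (\sum_(i < d) v i ord0 ^+ 2).

(* Canonical unit vectors are numbered from 1: [unitv R d k] has its 1 in the
   entry of type 'I_d whose value is k - 1, for 1 <= k <= d. *)
Definition unitv (R : realType) (d k : nat) : 'cV[R]_d :=
  \col_(i < d) (i.+1 == k)%:R.

(* The four Penrose equations. Note that [pinvmx] of mxalgebra is not the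
   Moore-Penrose pseudoinverse. *)
Definition is_pseudoinverse (R : realType) (p q : nat)
    (A : 'M[R]_(p, q)) (X : 'M[R]_(q, p)) : Prop :=
  [/\ A *m X *m A = A,
      X *m A *m X = X,
      (A *m X)^T = A *m X &
      (X *m A)^T = X *m A].

(* Over the reals the Penrose equations have exactly one solution, so the
   default value 0 is never taken. *)
Definition pseudoinverse (R : realType) (p q : nat) (A : 'M[R]_(p, q)) :
    'M[R]_(q, p) :=
  xget 0 [set X | is_pseudoinverse A X].

(* Meant for matrices with at least as many rows as columns, q <= p, where the
   singular values are the square roots of the q eigenvalues of A^T A. *)
Definition singular_value (R : realType) (p q : nat) (A : 'M[R]_(p, q))
    (s : R) : Prop :=
  0 <= s /\ eigenvalue (A^T *m A) (s ^+ 2).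

(* The set of singular values is finite, and nonempty when 0 < q, so that the
   infimum is a minimum. *)
Definition sigma_min (R : realType) (p q : nat) (A : 'M[R]_(p, q)) : R :=
  inf [set s | singular_value A s].

Definition orthonormal_columns (R : realType) (p q : nat) (A : 'M[R]_(p, q)) :
    Prop :=
  A^T *m A = 1%:M.

Definition fine_step (R : realType) (Tfinal : R) (mbar M : nat) : R :=
  Tfinal / (mbar * M)%:R.

Definition coarse_step (R : realType) (Tfinal : R) (M : nat) : R :=
  Tfinal / M%:R.

(* t^i *)
Definition fine_time (R : realType) (Tfinal : R) (mbar M i : nat) : R :=
  i%:R * fine_step Tfinal mbar M.

(* T^n *)
Definition coarse_time (R : realType) (Tfinal : R) (M n : nat) : R :=
  n%:R * coarse_step Tfinal M.

(* [F xi s t] is the state reached at time t from the state xi at time s; only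
   its values at fine time instances s <= t are constrained. *)
Definition fine_propagator (R : realType) (Tfinal : R) (mbar M N : nat)
    (F : 'cV[R]_N -> R -> R -> 'cV[R]_N) : Prop :=
  let t := fine_time Tfinal mbar M in
  forall (xi : 'cV[R]_N) (i j k : nat),
    (i <= j)%N -> (j <= k)%N -> (k <= mbar * M)%N ->
    F xi (t i) (t k) = F (F xi (t i) (t j)) (t j) (t k).

(* Z_0 *)
Definition sampling (R : realType) (alpha mbar : nat) : 'M[R]_(alpha, mbar) :=
  \matrix_(i < alpha, k < mbar) (i == k :> nat)%:R.

(* gamma_{ij}^n for Xi = Xi_j^n; the index i runs from 1 to alpha. *)
Definition gamma_coef (R : realType) (alpha mbar a : nat)
    (Xi : 'M[R]_(mbar, a)) (i : nat) : R :=
  ((unitv R mbar mbar)^T *m Xi *m pseudoinverse (sampling R alpha mbar *m Xi)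
    *m unitv R alpha i) ord0 ord0.

(* Gamma_i^n for the family Xi_1^n, ..., Xi_Nbar^n. *)
Definition Gamma_mx (R : realType) (alpha mbar a Nbar : nat)
    (Xi : 'I_Nbar -> 'M[R]_(mbar, a)) (i : nat) : 'M[R]_Nbar :=
  diag_mx (\row_(j < Nbar) gamma_coef alpha (Xi j) i).

(* G_LF(xi; T^n, T^{n+1}), with Rm and Pm the matrices R and P. *)
Definition local_forecast (R : realType) (Tfinal : R)
    (mbar M N Nbar alpha a : nat)
    (F : 'cV[R]_N -> R -> R -> 'cV[R]_N) (Rm Pm : 'M[R]_(N, Nbar))
    (Xi : 'I_M -> 'I_Nbar -> 'M[R]_(mbar, a))
    (xi : 'cV[R]_N) (n : 'I_M) : 'cV[R]_N :=
  let t := fine_time Tfinal mbar M in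
  let T := coarse_time Tfinal M in
  Pm *m Rm^T *m xi +
  Pm *m \sum_(1 <= i < alpha.+1)
    Gamma_mx alpha (Xi n) i *m
      (Rm^T *m F xi (T n) (t (mbar * n + i)%N) - Rm^T *m xi).

(* The vector with entries
   r_j^T F(xi; T^n, t^{mbar n + k}) - r_j^T xi, k = 1, ..., mbar;
   since ordinals start at 0, the entry of index k : 'I_mbar uses k.+1. *)
Definition time_evolution (R : realType) (Tfinal : R) (mbar M N Nbar : nat)
    (F : 'cV[R]_N -> R -> R -> 'cV[R]_N) (Rm : 'M[R]_(N, Nbar))
    (xi : 'cV[R]_N) (n : 'I_M) (j : 'I_Nbar) : 'cV[R]_mbar :=
  let t := fine_time Tfinal mbar M in
  let T := coarse_time Tfinal M in
  \col_(k < mbar)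
    (((col j Rm)^T *m F xi (T n) (t (mbar * n + k.+1)%N)) ord0 ord0
     - ((col j Rm)^T *m xi) ord0 ord0).

(* beta_j^n for Xi = Xi_j^n. *)
Definition beta (R : realType) (alpha mbar a : nat) (Xi : 'M[R]_(mbar, a)) : R :=
  1 / sigma_min (sampling R alpha mbar *m Xi).

(* Main.v *)
(** The decomposition of the identity gives
    [F - G = Pperp (Rperp^T F) + P res], where the [j]-th entry of [res] is the
    last entry of [(1 - Pi_j) u_j]: [u_j] is the local time evolution and
    [Pi_j := Xi_j (Z_0 Xi_j)^+ Z_0] is an oblique projector onto the range of
    [Xi_j]. Since [Pi_j] fixes that range, [u_j] may be replaced by
    [(1 - Xi_j Xi_j^T) u_j], and [1 - Pi_j] has norm at most
    [1 / sigma_min (Z_0 Xi_j)] on the orthogonal complement of the range. *)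

Require Import Defs.
From mathcomp Require Import all_boot all_order all_algebra.
From mathcomp Require Import boolp classical_sets reals.
From mathcomp Require Import ring lra.

Set Implicit Arguments.
Unset Strict Implicit.
Unset Printing Implicit Defensive.

Import Order.TTheory GRing.Theory Num.Theory.
Local Open Scope ring_scope.

(** * Euclidean inner product and quadratic forms *)

Definition dotv (R : realType) (d : nat) (u v : 'cV[R]_d) : R :=
  (u^T *m v) ord0 ord0.

Lemma dotvE (R : realType) (d : nat) (u v : 'cV[R]_d) :
  dotv u v = \sum_(i < d) u i ord0 * v i ord0.
Proof. by rewrite /dotv mxE; apply: eq_bigr => i _; rewrite mxE. Qed.

Lemma dotvC (R : realType) (d : nat) (u v : 'cV[R]_d) : dotv u v = dotv v u.
Proof. by rewrite !dotvE; apply: eq_bigr => i _; rewrite mulrC. Qed.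

Lemma dotvDr (R : realType) (d : nat) (u v w : 'cV[R]_d) :
  dotv u (v + w) = dotv u v + dotv u w.
Proof. by rewrite /dotv mulmxDr mxE. Qed.

Lemma dotvDl (R : realType) (d : nat) (u v w : 'cV[R]_d) :
  dotv (u + v) w = dotv u w + dotv v w.
Proof. by rewrite dotvC dotvDr !(dotvC w). Qed.

Lemma dotvZr (R : realType) (d : nat) (l : R) (u v : 'cV[R]_d) :
  dotv u (l *: v) = l * dotv u v.
Proof. by rewrite /dotv -scalemxAr mxE. Qed.

Lemma dotvZl (R : realType) (d : nat) (l : R) (u v : 'cV[R]_d) :
  dotv (l *: u) v = l * dotv u v.
Proof. by rewrite dotvC dotvZr dotvC. Qed.

Lemma dotvBr (R : realType) (d : nat) (u v w : 'cV[R]_d) :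
  dotv u (v - w) = dotv u v - dotv u w.
Proof. by rewrite dotvDr -scaleN1r dotvZr mulN1r. Qed.

Lemma dotvBl (R : realType) (d : nat) (u v w : 'cV[R]_d) :
  dotv (u - v) w = dotv u w - dotv v w.
Proof. by rewrite dotvC dotvBr !(dotvC w). Qed.

Lemma dotv_mulmxl (R : realType) (p q : nat) (A : 'M[R]_(p, q)) u v :
  dotv (A *m u) v = dotv u (A^T *m v).
Proof. by rewrite /dotv trmx_mul mulmxA. Qed.

Lemma dotv_ge0 (R : realType) (d : nat) (v : 'cV[R]_d) : 0 <= dotv v v.
Proof. by rewrite dotvE; apply: sumr_ge0 => i _; rewrite -expr2 sqr_ge0. Qed.

Lemma dotv_eq0 (R : realType) (d : nat) (v : 'cV[R]_d) :
  (dotv v v == 0) = (v == 0).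
Proof.
apply/eqP/eqP => [|->]; last by rewrite /dotv mulmx0 mxE.
rewrite dotvE => /eqP; rewrite psumr_eq0 => [/allP v0|i _]; last first.
  by rewrite -expr2 sqr_ge0.
apply/colP => i; have := v0 i (mem_index_enum i).
by rewrite /= mulf_eq0 orbb mxE => /eqP.
Qed.

Lemma dotv_gt0 (R : realType) (d : nat) (v : 'cV[R]_d) :
  v != 0 -> 0 < dotv v v.
Proof. by rewrite -dotv_eq0 => v0; rewrite lt_def v0 dotv_ge0. Qed.

Lemma dotv_entry (R : realType) (d : nat) (v : 'cV[R]_d) (i : 'I_d) :
  v i ord0 ^+ 2 <= dotv v v.
Proof.
rewrite dotvE (bigD1 i) //= -expr2 lerDl.
by apply: sumr_ge0 => k _; rewrite -expr2 sqr_ge0.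
Qed.

(** The form of [A] at [u + t *: v] is a nonnegative quadratic in [t]. As [A] is only semidefinite,
    its leading coefficient may vanish. *)
Lemma psd_CauchySchwarz (R : realType) (d : nat) (A : 'M[R]_d)
    (u v : 'cV[R]_d) :
  A^T = A -> (forall x : 'cV[R]_d, 0 <= dotv x (A *m x)) ->
  dotv u (A *m v) ^+ 2 <= dotv u (A *m u) * dotv v (A *m v).
Proof.
move=> symA psdA.
have quad t : 0 <= dotv u (A *m u) + t * dotv u (A *m v) *+ 2
                   + t ^+ 2 * dotv v (A *m v).
  have := psdA (u + t *: v).
  rewrite mulmxDr -scalemxAr !(dotvDr, dotvDl, dotvZr, dotvZl).
  have -> : dotv v (A *m u) = dotv u (A *m v).
    by rewrite dotvC dotv_mulmxl symA.
  by congr (0 <= _); ring.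
move: quad (psdA u) (psdA v).
set p := dotv u (A *m u); set b := dotv u (A *m v); set q := dotv v (A *m v).
move=> quad p0; rewrite le_eqVlt => /orP[/eqP q0|q0].
  rewrite -q0 mulr0.
  have [->|b0] := eqVneq b 0; first by rewrite expr0n.
  (* With [q = 0] the quadratic is affine in [t]; this [t] gives it the value -1. *)
  have := quad (- (p + 1) / (2 * b)).
  rewrite -q0 mulr0 addr0.
  have -> : p + - (p + 1) / (2 * b) * b *+ 2 = -1 by field.
  by rewrite lerNr oppr0 ler10.
(* The minimizer of the quadratic. *)
have := quad (- b / q).
have -> : p + - b / q * b *+ 2 + (- b / q) ^+ 2 * q = (p * q - b ^+ 2) / q.
  by field; rewrite gt_eqF.
by rewrite pmulr_lge0 ?invr_gt0 // subr_ge0.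
Qed.

Lemma dotv_CauchySchwarz (R : realType) (d : nat) (u v : 'cV[R]_d) :
  dotv u v ^+ 2 <= dotv u u * dotv v v.
Proof.
have := @psd_CauchySchwarz R d 1%:M u v (trmx1 _ _); rewrite !mul1mx.
by apply=> x; rewrite mul1mx dotv_ge0.
Qed.

(** Each [|x_i x_j|] is at most [|x|^2], so the sum of the [|A i j|] is a bound; the added 1 makes
    [C] positive, hence invertible. *)
Lemma quadratic_form_bounded (R : realType) (d : nat) (A : 'M[R]_d) :
  exists2 C : R, 0 < C &
    forall x : 'cV[R]_d, dotv x (A *m x) <= C * dotv x x.
Proof.
exists (1 + \sum_i \sum_j `|A i j|) => [|x].
  rewrite ltr_pwDl //.
  by apply: sumr_ge0 => i _; apply: sumr_ge0 => j _; rewrite normr_ge0.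
rewrite mulrDl mul1r; apply: ler_wpDl; first exact: dotv_ge0.
rewrite {1}dotvE mulr_suml; apply: ler_sum => i _.
rewrite mxE mulr_suml mulr_sumr; apply: ler_sum => j _.
have -> : x i ord0 * (A i j * x j ord0) = A i j * (x i ord0 * x j ord0) by ring.
apply: le_trans (ler_norm _) _; rewrite normrM ler_wpM2l //.
have /ler_normlP[] : `|x i ord0 * x j ord0| <= dotv x x; last first.
  by move=> h1 h2; rewrite ler_norml; apply/andP; split=> //; lra.
have := dotv_entry x i; have := dotv_entry x j.
by rewrite ler_norml; move=> ? ?; apply/andP; split; nra.
Qed.

(** * Euclidean norm *)

Lemma enorm_ge0 (R : realType) (d : nat) (v : 'cV[R]_d) : 0 <= enorm v.
Proof. exact: sqrtr_ge0. Qed.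

Lemma enorm_sqr (R : realType) (d : nat) (v : 'cV[R]_d) :
  enorm v ^+ 2 = dotv v v.
Proof.
rewrite /enorm sqr_sqrtr; first by rewrite dotvE; apply: eq_bigr => i _.
by apply: sumr_ge0 => i _; rewrite sqr_ge0.
Qed.

Lemma ler_enormD (R : realType) (d : nat) (u v : 'cV[R]_d) :
  enorm (u + v) <= enorm u + enorm v.
Proof.
rewrite -(@ler_pXn2r _ 2) ?nnegrE ?addr_ge0 ?enorm_ge0 //.
rewrite sqrrD !enorm_sqr dotvDl !dotvDr (dotvC v u).
have uv : dotv u v <= enorm u * enorm v.
  apply: le_trans (ler_norm _) _.
  rewrite -(@ler_pXn2r _ 2) ?nnegrE ?mulr_ge0 ?enorm_ge0 //.
  by rewrite real_normK ?num_real // exprMn !enorm_sqr dotv_CauchySchwarz.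
lra.
Qed.

Lemma enorm_le_sum (R : realType) (d : nat) (v : 'cV[R]_d) :
  enorm v <= \sum_(i < d) `|v i ord0|.
Proof.
have s0 : 0 <= \sum_(i < d) `|v i ord0| by apply: sumr_ge0.
rewrite -(@ler_pXn2r _ 2) ?nnegrE ?enorm_ge0 // enorm_sqr dotvE.
rewrite expr2 mulr_suml; apply: ler_sum => i _.
rewrite -expr2 -[leLHS]real_normK ?num_real // expr2 ler_wpM2l //.
by rewrite (bigD1 i) //= lerDl; apply: sumr_ge0.
Qed.

(** * Gram matrices, smallest singular value and pseudoinverse *)

Lemma full_rank_injective (R : realType) (p q : nat) (A : 'M[R]_(p, q))
    (v : 'cV[R]_q) :
  \rank A = q -> A *m v = 0 -> v = 0.
Proof.
move=> rkA Av0; have /row_fullP[C CA] : row_full A by rewrite /row_full rkA.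
by rewrite -[v]mul1mx -CA -mulmxA Av0 mulmx0.
Qed.

(** If [v A^T A = 0] then [|A v^T|^2 = 0], so the kernel is trivial. *)
Lemma gram_unitmx (R : realType) (p q : nat) (A : 'M[R]_(p, q)) :
  \rank A = q -> A^T *m A \in unitmx.
Proof.
move=> rkA; rewrite -row_free_unit -kermx_eq0; apply/eqP/row_matrixP => i.
set v := row i _.
have vG0 : v *m (A^T *m A) = 0 by rewrite -row_mul mulmx_ker row0.
rewrite row0; apply: trmx_inj; rewrite trmx0; apply: (full_rank_injective rkA).
apply/eqP; rewrite -dotv_eq0 /dotv trmx_mul trmxK.
by rewrite -mulmxA (mulmxA A^T) mulmxA vG0 mul0mx mxE.
Qed.

(* The largest [l] with [l |x|^2 <= |Ax|^2] for all [x] is an eigenvalue of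
   [A^T A]: otherwise [T := A^T A - l] is invertible, and Cauchy-Schwarz for
   the form of [T] at [T^-1 x] and [x] bounds [|x|^2] by a multiple of
   [x^T T x], so that [l] could be increased. *)
Lemma least_eigenvalue_gram (R : realType) (p q : nat) (A : 'M[R]_(p, q)) :
  (0 < q)%N ->
  exists l : R, [/\ 0 <= l, eigenvalue (A^T *m A) l &
    forall x : 'cV[R]_q, l * dotv x x <= dotv (A *m x) (A *m x)].
Proof.
move=> q_gt0.
pose E := [set l : R | forall x : 'cV[R]_q,
  l * dotv x x <= dotv (A *m x) (A *m x)]%classic.
have E0 : E 0 by move=> x; rewrite mul0r dotv_ge0.
have quotE l (x : 'cV[R]_q) : E l -> x != 0 ->
    l <= dotv (A *m x) (A *m x) / dotv x x.
  by move=> El x0; rewrite ler_pdivlMr ?dotv_gt0 //; exact: El.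
have supE : has_sup E.
  split; first by exists 0.
  pose x : 'cV[R]_q := const_mx 1.
  have x0 : x != 0.
    apply/eqP => /colP/(_ (Ordinal q_gt0)); rewrite !mxE => /eqP.
    by rewrite oner_eq0.
  by exists (dotv (A *m x) (A *m x) / dotv x x) => l El; exact: quotE.
have Esup : E (sup E).
  (* [E] consists of the lower bounds of all Rayleigh quotients, hence contains its supremum. *)
  move=> x; have [->|x0] := eqVneq x 0.
    by rewrite mulmx0 /dotv !mulmx0 !mxE mulr0.
  rewrite -ler_pdivlMr ?dotv_gt0 //; apply: ge_sup; first by exists 0.
  by move=> l El; exact: quotE.
exists (sup E); split; [by apply: ub_le_sup => //; case: supE| |exact: Esup].
apply: contraT => neig.
pose T : 'M[R]_q := A^T *m A - (sup E)%:M.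
have uT : T \in unitmx.
  by move: neig; rewrite /eigenvalue /eigenspace negbK kermx_eq0 row_free_unit.
have TE x : dotv x (T *m x) = dotv (A *m x) (A *m x) - sup E * dotv x x.
  by rewrite /T mulmxBl dotvBr mul_scalar_mx dotvZr dotv_mulmxl mulmxA.
have symT : T^T = T.
  by rewrite /T linearB /= trmx_mul trmxK tr_scalar_mx.
have psdT x : 0 <= dotv x (T *m x) by rewrite TE subr_ge0; exact: Esup.
have [C C_gt0 bC] := quadratic_form_bounded (invmx T).
suff EC : E (sup E + C^-1).
  have : sup E + C^-1 <= sup E by apply: ub_le_sup => //; case: supE.
  by rewrite gerDl leNgt invr_gt0 C_gt0.
move=> x; have [->|x0] := eqVneq x 0.
  by rewrite mulmx0 /dotv !mulmx0 !mxE mulr0.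
have xx := dotv_gt0 x0.
have := psd_CauchySchwarz (invmx T *m x) x symT psdT.
rewrite mulKVmx // [dotv _ (T *m x)]dotvC dotv_mulmxl symT mulKVmx //.
rewrite (dotvC (invmx T *m x)).
move=> CS; rewrite mulrDl -lerBrDl -TE ler_pdivrMl //.
rewrite -(ler_pM2l xx) -expr2; apply: le_trans CS _.
rewrite mulrA [dotv x x * C]mulrC.
by rewrite ler_wpM2r.
Qed.

(** The infimum is attained at the root of the least eigenvalue [l]: an eigenvector [v] for [s ^+ 2]
    gives [l |v|^2 <= |A v|^2 = s^2 |v|^2]. Eigenvectors are rows here, hence [v^T] in the proof. *)
Lemma sigma_min_bound (R : realType) (p q : nat) (A : 'M[R]_(p, q)) :
  (0 < q)%N ->
  singular_value A (sigma_min A) /\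
  forall x : 'cV[R]_q,
    sigma_min A ^+ 2 * dotv x x <= dotv (A *m x) (A *m x).
Proof.
move=> q_gt0; have [l [l0 el bl]] := least_eigenvalue_gram A q_gt0.
suff -> : sigma_min A = Num.sqrt l.
  by rewrite /singular_value sqr_sqrtr // sqrtr_ge0.
have sl : singular_value A (Num.sqrt l).
  by rewrite /singular_value sqr_sqrtr // sqrtr_ge0.
apply/eqP; rewrite eq_le; apply/andP; split.
  by apply: ge_inf => //; exists 0 => s [].
apply: lb_le_inf; first by exists (Num.sqrt l).
move=> s [s0 /eigenvalueP[v vS v0]].
rewrite -(@ler_pXn2r _ 2) ?nnegrE ?sqrtr_ge0 // sqr_sqrtr //.
have vT0 : v^T != 0 by rewrite -trmx0 (inj_eq trmx_inj).
rewrite -(ler_pM2r (dotv_gt0 vT0)); apply: le_trans (bl _) _.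
rewrite /dotv trmx_mul trmxK -mulmxA (mulmxA A^T) mulmxA vS.
by rewrite -scalemxAl mxE.
Qed.

Lemma sigma_min_gt0 (R : realType) (p q : nat) (A : 'M[R]_(p, q)) :
  (0 < q)%N -> \rank A = q -> 0 < sigma_min A.
Proof.
move=> q_gt0 rkA; have [[s0 eig] _] := sigma_min_bound A q_gt0.
rewrite lt_def s0 andbT; apply/eqP => s_eq0; move: eig.
rewrite s_eq0 expr0n /eigenvalue /eigenspace raddf0 subr0 kermx_eq0.
by rewrite row_free_unit gram_unitmx.
Qed.

(** At full column rank [(A^T A)^-1 A^T] solves the Penrose equations, so [xget] does not return its
    default. The left inverse comes from cancelling [A] in [A X A = A], the second identity from the
    symmetry of [A X]. *)
Lemma pseudoinverseP (R : realType) (p q : nat) (A : 'M[R]_(p, q)) :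
  \rank A = q ->
  pseudoinverse A *m A = 1%:M /\ A^T *m (A *m pseudoinverse A) = A^T.
Proof.
move=> rkA; have uG := gram_unitmx rkA.
have : is_pseudoinverse A (pseudoinverse A).
  apply: (@xgetPex _ 0 [set X | is_pseudoinverse A X]%classic).
  exists (invmx (A^T *m A) *m A^T).
  have XA : invmx (A^T *m A) *m A^T *m A = 1%:M by rewrite -mulmxA mulVmx.
  split; last by rewrite XA trmx1.
  - by rewrite -mulmxA XA mulmx1.
  - by rewrite XA mul1mx.
  - by rewrite !trmx_mul trmxK trmx_inv trmx_mul trmxK mulmxA.
case=> AXA _ symAX _; split; last by rewrite -symAX -trmx_mul AXA.
have /row_fullP[C CA] : row_full A by rewrite /row_full rkA.
by rewrite -[LHS]mul1mx -CA -mulmxA (mulmxA A) AXA.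
Qed.

(** * Coisometries and the oblique projector *)

Lemma sampling_trK (R : realType) (alpha mbar : nat) :
  (alpha <= mbar)%N ->
  sampling R alpha mbar *m (sampling R alpha mbar)^T = 1%:M.
Proof.
move=> le_am; apply/matrixP => i j; rewrite !mxE.
rewrite (bigD1 (widen_ord le_am i)) //= big1 ?addr0.
  by rewrite !mxE eqxx mul1r eq_sym.
move=> k /eqP ki; rewrite !mxE.
case: eqP => [ik|]; last by rewrite mul0r.
by case: ki; apply: val_inj.
Qed.

Lemma dotv_isometry (R : realType) (p q : nat) (U : 'M[R]_(p, q)) u v :
  U^T *m U = 1%:M -> dotv (U *m u) (U *m v) = dotv u v.
Proof. by move=> UU; rewrite dotv_mulmxl mulmxA UU mul1mx. Qed.

(* Splitting along the range of [Z^T Z], on which [Z] is isometric. *)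
Lemma dotv_coisometry_split (R : realType) (p q : nat) (Z : 'M[R]_(p, q))
    (u v : 'cV[R]_q) :
  Z *m Z^T = 1%:M ->
  dotv u v = dotv (Z *m u) (Z *m v)
           + dotv (u - Z^T *m (Z *m u)) (v - Z^T *m (Z *m v)).
Proof.
move=> ZZ; rewrite !dotvBl !dotvBr !dotv_mulmxl !trmxK.
rewrite (mulmxA Z) ZZ mul1mx; ring.
Qed.

(** For any nonzero [x], [sigma_min * |x| <= |Z Xi x| <= |Xi x| = |x|]. This yields [beta >= 1]. *)
Lemma sigma_min_le1 (R : realType) (p q a : nat) (Z : 'M[R]_(p, q))
    (Xi : 'M[R]_(q, a)) :
  (0 < a)%N -> Z *m Z^T = 1%:M -> orthonormal_columns Xi ->
  sigma_min (Z *m Xi) <= 1.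
Proof.
move=> a_gt0 ZZ oXi; have [[s0 _] bs] := sigma_min_bound (Z *m Xi) a_gt0.
pose x : 'cV[R]_a := const_mx 1.
have x0 : x != 0.
  apply/eqP => /colP/(_ (Ordinal a_gt0)); rewrite !mxE => /eqP.
  by rewrite oner_eq0.
rewrite -(@ler_pXn2r _ 2) ?nnegrE // expr1n -(ler_pM2r (dotv_gt0 x0)).
apply: le_trans (bs x) _; rewrite mul1r -(dotv_isometry x x oXi) -mulmxA.
by rewrite [leRHS](dotv_coisometry_split _ _ ZZ) lerDl dotv_ge0.
Qed.

(* The complementary oblique projector has norm at most [1 / sigma_min], with
   no loss of a constant: for [c := X Z w], [x := |Z Xi c|^2] and
   [y := |c|^2 - x], the two halves of [w] give [x <= |Z w|^2] and
   [x^2 <= y (|w|^2 - |Z w|^2)], hence [x |c|^2 <= y |w|^2]. *)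
Lemma oblique_projector_bound (R : realType) (p q a : nat)
    (Z : 'M[R]_(p, q)) (Xi : 'M[R]_(q, a)) (X := pseudoinverse (Z *m Xi))
    (w : 'cV[R]_q) :
  (0 < a)%N -> Z *m Z^T = 1%:M -> orthonormal_columns Xi ->
  \rank (Z *m Xi) = a -> Xi^T *m w = 0 ->
  sigma_min (Z *m Xi) * enorm (w - Xi *m X *m Z *m w) <= enorm w.
Proof.
move=> a_gt0 ZZ oXi rkB Xiw.
have s0 := sigma_min_gt0 a_gt0 rkB; have s1 := sigma_min_le1 a_gt0 ZZ oXi.
have [_ bs] := sigma_min_bound (Z *m Xi) a_gt0.
have [_ BBX] := pseudoinverseP rkB.
rewrite -(@ler_pXn2r _ 2) ?nnegrE ?mulr_ge0 ?enorm_ge0 ?(ltW s0) //.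
rewrite exprMn !enorm_sqr.
pose c := X *m (Z *m w).
have -> : w - Xi *m X *m Z *m w = w - Xi *m c by rewrite /c !mulmxA.
have wXi : dotv (Xi *m c) w = 0 by rewrite dotv_mulmxl Xiw /dotv mulmx0 mxE.
(* Pythagoras: [w] is orthogonal to the range of [Xi]. *)
have -> : dotv (w - Xi *m c) (w - Xi *m c) = dotv w w + dotv c c.
  by rewrite dotvBl !dotvBr (dotvC w) wXi dotv_isometry //; ring.
have := bs c; rewrite -mulmxA.
set x := dotv (Z *m (Xi *m c)) (Z *m (Xi *m c)) => sc.
(* [Z Xi c] is the orthogonal projection of [Z w] onto the range of [Z Xi]. *)
have xE : x = dotv (Z *m (Xi *m c)) (Z *m w).
  rewrite /x mulmxA [LHS]dotv_mulmxl [RHS]dotv_mulmxl; congr dotv.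
  by rewrite /c (mulmxA _ X) mulmxA BBX.
have CS1 : x ^+ 2 <= x * dotv (Z *m w) (Z *m w).
  by rewrite {1}xE; exact: dotv_CauchySchwarz.
have := dotv_coisometry_split (Xi *m c) w ZZ; rewrite wXi -xE.
have := dotv_coisometry_split (Xi *m c) (Xi *m c) ZZ.
rewrite (dotv_isometry _ _ oXi) -/x.
have := dotv_coisometry_split w w ZZ.
have := dotv_CauchySchwarz (Xi *m c - Z^T *m (Z *m (Xi *m c)))
  (w - Z^T *m (Z *m w)).
set W1 := dotv (Z *m w) (Z *m w) in CS1 *.
set b := dotv (Xi *m c - _) (w - _).
set W2 := dotv (w - _) (w - _); set y := dotv (Xi *m c - _) _.
move=> CS2 -> yE xb.
have W10 : 0 <= W1 by exact: dotv_ge0.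
have W20 : 0 <= W2 by exact: dotv_ge0.
have y0 : 0 <= y by exact: dotv_ge0.
have x0 : 0 <= x by exact: dotv_ge0.
have c0 : 0 <= dotv c c by exact: dotv_ge0.
have s21 : sigma_min (Z *m Xi) ^+ 2 <= 1 by rewrite expr_le1 // ltW.
have s20 : 0 < sigma_min (Z *m Xi) ^+ 2 by rewrite exprn_gt0.
move: c0 s21 s20 sc yE; set s := _ ^+ 2; set C := dotv c c.
rewrite le_eqVlt => /orP[/eqP <-|C0] s21 s20 sc yE.
  by rewrite addr0 ler_piMl ?addr_ge0.
have x_gt0 : 0 < x by apply: lt_le_trans sc; rewrite mulr_gt0.
have xW1 : x <= W1 by rewrite -(ler_pM2l x_gt0) -expr2.
have xC : x * C <= y * (W1 + W2) by rewrite yE; nra.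
(* Since [s * C <= x], [y = C - x] is at most [(1 - s) * C]. Cancelling [C] leaves
   [s * C <= x <= (1 - s) * (W1 + W2)], which rearranges to the goal. *)
have yC : y * (W1 + W2) <= (1 - s) * C * (W1 + W2).
  by rewrite ler_wpM2r ?addr_ge0 //; lra.
have : x <= (1 - s) * (W1 + W2).
  rewrite -(ler_pM2r C0); apply: le_trans xC _; apply: le_trans yC _.
  by rewrite mulrAC.
nra.
Qed.

Lemma oblique_residual_bound (R : realType) (p q a : nat)
    (Z : 'M[R]_(p, q)) (Xi : 'M[R]_(q, a)) (u : 'cV[R]_q) :
  (0 < a)%N -> Z *m Z^T = 1%:M -> orthonormal_columns Xi ->
  \rank (Z *m Xi) = a ->
  enorm (u - Xi *m pseudoinverse (Z *m Xi) *m Z *m u)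
  <= (sigma_min (Z *m Xi))^-1 * enorm ((1%:M - Xi *m Xi^T) *m u).
Proof.
move=> a_gt0 ZZ oXi rkB; have s0 := sigma_min_gt0 a_gt0 rkB.
set w := (1%:M - Xi *m Xi^T) *m u.
have Xiw : Xi^T *m w = 0.
  by rewrite /w mulmxA mulmxBr mulmx1 mulmxA oXi mul1mx subrr mul0mx.
rewrite ler_pdivlMl //.
suff -> : u - Xi *m pseudoinverse (Z *m Xi) *m Z *m u
        = w - Xi *m pseudoinverse (Z *m Xi) *m Z *m w.
  exact: oblique_projector_bound.
have [XB _] := pseudoinverseP rkB.
(* The projector fixes [Xi], so removing [Xi Xi^T u] from [u] leaves the residual unchanged. *)
have fixXi : Xi *m pseudoinverse (Z *m Xi) *m Z *m Xi = Xi.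
  by rewrite -!mulmxA XB mulmx1.
rewrite /w mulmxBl mul1mx mulmxBr [in RHS]mulmxA [in RHS]mulmxA fixXi -mulmxA.
by rewrite opprB addrA subrK.
Qed.

(** * Forecast coefficients and the error estimate *)

Lemma ler_entry_enorm (R : realType) (d : nat) (v : 'cV[R]_d) (i : 'I_d) :
  `|v i ord0| <= enorm v.
Proof.
rewrite -(@ler_pXn2r _ 2) ?nnegrE ?enorm_ge0 //.
by rewrite real_normK ?num_real // enorm_sqr dotv_entry.
Qed.

(** The coefficients form the last row of [Xi (Z_0 Xi)^+], and [Z_0] keeps [f 1, ..., f alpha]. The
    ordinal [l], of value [mbar - 1], is the index of the last entry. *)
Lemma sum_gamma_coef (R : realType) (alpha mbar a : nat)
    (Xi : 'M[R]_(mbar, a)) (f : nat -> R) (l : 'I_mbar) :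
  (alpha <= mbar)%N -> l.+1 = mbar ->
  \sum_(1 <= i < alpha.+1) gamma_coef alpha Xi i * f i
  = (Xi *m pseudoinverse (sampling R alpha mbar *m Xi)
       *m sampling R alpha mbar *m \col_(k < mbar) f k.+1) l ord0.
Proof.
move=> le_am l_last; rewrite -[in RHS]mulmxA mxE big_add1 big_mkord.
apply: eq_bigr => i _; congr (_ * _).
  rewrite /gamma_coef -(mulmxA _ Xi) mxE (bigD1 i) //= big1 => [|k ki].
    rewrite addr0 [X in _ * X]mxE eqxx mulr1 mxE (bigD1 l) //= big1 => [|k kl].
      by rewrite addr0 !mxE l_last eqxx mul1r.
    rewrite !mxE -[X in _ == X]l_last eqSS.
    by rewrite (inj_eq val_inj) (negPf kl) mul0r.
  by rewrite [X in _ * X]mxE eqSS (inj_eq val_inj) (negPf ki) mulr0.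
rewrite mxE (bigD1 (widen_ord le_am i)) //= big1 => [|k ki].
  by rewrite addr0 !mxE eqxx mul1r.
rewrite [X in X * _]mxE; have [ik|_] := eqVneq (nat_of_ord i) k; last by rewrite mul0r.
by case/eqP: ki; apply: val_inj.
Qed.

Theorem theorem4p1 (R : realType) (N M mbar : nat) (Tfinal : R)
    (Nbar alpha a : nat)
    (F : 'cV[R]_N -> R -> R -> 'cV[R]_N)
    (Rm Pm : 'M[R]_(N, Nbar))
    (Xi : 'I_M -> 'I_Nbar -> 'M[R]_(mbar, a))
    (Rperp Pperp : 'M[R]_(N, N - Nbar))
    (MP MPperp : R)
    (N_gt0 : (0 < N)%N) (M_gt0 : (0 < M)%N) (mbar_gt0 : (0 < mbar)%N)
    (Tfinal_gt0 : 0 < Tfinal)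
    (HF : fine_propagator Tfinal mbar M F)
    (Nbar_gt0 : (0 < Nbar)%N) (Nbar_le : (Nbar <= N)%N)
    (a_gt0 : (0 < a)%N) (alpha_gt0 : (0 < alpha)%N)
    (a_le : (a <= alpha)%N) (alpha_le : (alpha <= mbar)%N)
    (Xi_orth : forall n j, orthonormal_columns (Xi n j))
    (Xi_rank : forall n j, \rank (sampling R alpha mbar *m Xi n j) = a)
    (decomp : forall xi : 'cV[R]_N,
        xi = Pm *m Rm^T *m xi + Pperp *m Rperp^T *m xi)
    (Pm_bound : forall eta : 'cV[R]_Nbar,
        enorm (Pm *m eta) <= MP * enorm eta)
    (Pperp_bound : forall eta : 'cV[R]_(N - Nbar),
        enorm (Pperp *m eta) <= MPperp * enorm eta) :
  let T := coarse_time Tfinal M in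
  (forall (n : 'I_M) (j : 'I_Nbar), 1 <= beta alpha (Xi n j)) /\
  (forall (xi : 'cV[R]_N) (n : 'I_M),
     enorm (F xi (T n) (T n.+1)
            - local_forecast Tfinal alpha F Rm Pm Xi xi n)
     <= MPperp * enorm (Rperp^T *m F xi (T n) (T n.+1))
        + MP * \sum_(j < Nbar)
            beta alpha (Xi n j) *
            enorm ((1%:M - Xi n j *m (Xi n j)^T)
                   *m time_evolution Tfinal mbar F Rm xi n j)).
Proof.
move=> T; have betaE n j : beta alpha (Xi n j)
    = (sigma_min (sampling R alpha mbar *m Xi n j))^-1 by rewrite /beta div1r.
have ZZ := sampling_trK R alpha_le.
split=> [n j|xi n].
  rewrite betaE invf_ge1 ?sigma_min_le1 //; exact: sigma_min_gt0.
(* The sign of [MP] follows from its bound at a nonzero vector, which exists as [0 < Nbar]. *)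
have MP_ge0 : 0 <= MP.
  pose x : 'cV[R]_Nbar := const_mx 1.
  have x0 : 0 < enorm x.
    apply: lt_le_trans (ler_entry_enorm x (Ordinal Nbar_gt0)).
    by rewrite mxE normr1.
  rewrite -(pmulr_lge0 _ x0); exact: le_trans (enorm_ge0 _) (Pm_bound x).
have [l l_last] : exists l : 'I_mbar, l.+1 = mbar.
  by case: (mbar) mbar_gt0 => // k _; exists ord_max.
(* The coarse time [T^{n+1}] as a fine time, so that both expressions give [F] the same real
   argument. *)
have TE : T n.+1 = fine_time Tfinal mbar M (mbar * n + l.+1)%N.
  rewrite l_last /T /coarse_time /coarse_step /fine_time /fine_step.
  rewrite -mulnSr !natrM; field.
  by rewrite !pnatr_eq0 -!lt0n M_gt0.
have colE (v : 'cV[R]_N) j : ((col j Rm)^T *m v) ord0 ord0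
    = (Rm^T *m v) j ord0.
  by rewrite !mxE; apply: eq_bigr => k _; rewrite !mxE.
have subE d (v w : 'cV[R]_d) k : (v - w) k ord0 = v k ord0 - w k ord0.
  by rewrite !mxE.
set y := F xi (T n) (T n.+1).
pose S := \sum_(1 <= i < alpha.+1) Gamma_mx alpha (Xi n) i *m
  (Rm^T *m F xi (T n) (fine_time Tfinal mbar M (mbar * n + i)%N) - Rm^T *m xi).
pose res := Rm^T *m y - Rm^T *m xi - S.
(* Only [y] is decomposed; [P R^T xi] comes from the propagator and goes into [res]. *)
have -> : y - local_forecast Tfinal alpha F Rm Pm Xi xi n
    = Pperp *m (Rperp^T *m y) + Pm *m res.
  rewrite {1}(decomp y) /local_forecast -/S /res !mulmxBr !mulmxA.
  rewrite opprD !addrA; congr (_ - _ - _); exact: addrC.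
apply: le_trans (ler_enormD _ _) _; apply: lerD => //.
apply: le_trans (Pm_bound _) _; rewrite ler_wpM2l //.
(* Bounding the 2-norm of [res] by its 1-norm produces the sum over [j]. *)
apply: le_trans (enorm_le_sum _) _; apply: ler_sum => j _.
rewrite betaE; set u := time_evolution _ _ _ _ _ _ _.
apply: le_trans (oblique_residual_bound u a_gt0 ZZ (Xi_orth n j) (Xi_rank n j)).
(* Entry [j] of [res] equals entry [l] of the oblique residual of [u]. *)
apply: le_trans (ler_entry_enorm _ l); rewrite le_eqVlt; apply/orP; left.
apply/eqP; congr `|_|.
rewrite /res !subE; congr (_ - _).
  by rewrite [RHS]mxE !colE -TE.
pose f i := ((col j Rm)^T
    *m F xi (T n) (fine_time Tfinal mbar M (mbar * n + i)%N)) ord0 ord0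
  - ((col j Rm)^T *m xi) ord0 ord0.
rewrite -(sum_gamma_coef (Xi n j) f alpha_le l_last) /S summxE.
apply: eq_bigr => i _; rewrite /Gamma_mx mul_diag_mx mxE mxE; congr (_ * _).
by rewrite subE /f !colE.
Qed.
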